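(* For all integers $m\ge1$ and $0\le j\le m-1$, the coefficients $p_j(m)$ of the Binet polynomial $b_m(\alpha)=\sum_{j=0}^{m-1}p_j(m)\alpha^j$ can be expressed in terms of the numbers $c_m=b_m(0)$ as $$p_j(m)=\sum_{l=j}^{m-1}\binom{m-1}{l}S_l^{(j)}(-1)^{l-j}c_{m-l} .$$
   Context: $S_m^{(k)}$ denotes the (signed) Stirling number of the first kind, defined by $\prod_{k=0}^{m-1}(x-k)=\sum_{k=0}^{m}S_m^{(k)}x^k$ (with $S_0^{(0)}=1$). For $m\ge1$ the Binet polynomial is $$b_m(\alpha)=\frac1m\sum_{k=1}^{m}\left\{\frac{\alpha^{k+2}-(\alpha-1)^{k+2}}{k+2}+\frac{\left(\frac12-\alpha\right)\left(\alpha^{k+1}-(\alpha-1)^{k+1}\right)}{k+1}\right\}(-1)^{k-m}S_m^{(k)},$$ equivalently $b_m(\alpha)=\frac1m\int_{\alpha-1}^{\alpha}\left(x+\frac12-\alpha\right)\prod_{k=0}^{m-1}(k+x)\,dx$; it is a polynomial of degree $m-1$ in $\alpha$, and $p_j(m)$ is its coefficient of $\alpha^j$. The numbers $c_m=b_m(0)$ are given by $c_m=\frac{(-1)^{m-1}}{2m}\sum_{k=1}^{m}\frac{k\,S_m^{(k)}}{(k+2)(k+1)}$. *)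

(* Defs.v *)
From HB Require Import structures.
From mathcomp Require Import all_boot all_order all_algebra.

Set Implicit Arguments.
Unset Strict Implicit.
Unset Printing Implicit Defensive.

Import Order.TTheory GRing.Theory Num.Theory.
Local Open Scope ring_scope.

(* Signed Stirling numbers of the first kind S_m^(k), read off from their
   generating polynomial x (x - 1) ... (x - m + 1). *)
Definition stirling1 (m k : nat) : int :=
  (\prod_(i < m) ('X - (i%:R : int)%:P))`_k.

(* The variable alpha is the indeterminate 'X. The sign (-1)^(k - m) has a
   nonpositive exponent, hence the integer power. *)
Definition binet_poly (R : numFieldType) (m : nat) : {poly R} :=
  m%:R^-1 *: \sum_(1 <= k < m.+1)
    ((-1) ^ (k%:Z - m%:Z) * (stirling1 m k)%:~R) *:
      ((k + 2)%:R^-1 *: ('X^(k + 2) - ('X - 1) ^+ (k + 2))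
       + (k + 1)%:R^-1 *:
           ((2%:R^-1%:P - 'X) * ('X^(k + 1) - ('X - 1) ^+ (k + 1)))).

Definition binet_coef (R : numFieldType) (j m : nat) : R := (binet_poly R m)`_j.

Definition binet_c (R : numFieldType) (m : nat) : R := (binet_poly R m).[0].

(* Main.v *)
(* Let r_m(x) = x (x + 1) ... (x + m - 1). After the substitution
   x = t + alpha, m b_m(alpha) is the integral of (t + 1/2) r_m(t + alpha) over
   t in [-1, 0]. Expanding r_m(t + alpha) by the Vandermonde identity
   r_m(x + y) = sum_l C(m, l) r_l(x) r_(m - l)(y), and using
   C(m, l) (m - l) / m = C(m - 1, l), gives
   b_m(alpha) = sum_(l < m) C(m - 1, l) c_(m - l) r_l(alpha); the term l = m
   drops out because t + 1/2 has integral zero. Integrals are replaced by their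
   values on monomials, which form an Appell sequence (B_k' = k B_(k - 1)). *)
Require Import Defs.
From HB Require Import structures.
From mathcomp Require Import all_boot all_order all_algebra.
From mathcomp Require Import ring.

Set Implicit Arguments.
Unset Strict Implicit.
Unset Printing Implicit Defensive.

Import Order.TTheory GRing.Theory Num.Theory.
Local Open Scope ring_scope.

(** Stated over any commutative ring, so that scalars, ['X] and ['X + a%:P] are all admissible
    arguments. *)
Definition rising (A : comNzRingType) (x : A) (m : nat) : A :=
  \prod_(i < m) (x + i%:R).

Lemma risingS (A : comNzRingType) (x : A) (m : nat) :
  rising x m.+1 = rising x m * (x + m%:R).
Proof. by rewrite /rising big_ord_recr. Qed.

(** Induction on [m]: the new factor x + y + m splits as (x + l) + (y + (m - l)), each half extends
    one of the two factorials, and Pascal's rule merges the sums. *)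
Lemma rising_add (A : comNzRingType) (x y : A) (m : nat) :
  rising (x + y) m =
    \sum_(l < m.+1) 'C(m, l)%:R * (rising x l * rising y (m - l)).
Proof.
elim: m => [|m IHm].
  by rewrite big_ord1 bin0 /rising !big_ord0 !mulr1.
rewrite risingS IHm mulr_suml.
have -> : \sum_(l < m.+1) 'C(m, l)%:R * (rising x l * rising y (m - l))
            * (x + y + m%:R)
        = \sum_(l < m.+1) 'C(m, l)%:R * (rising x l.+1 * rising y (m - l))
        + \sum_(l < m.+1) 'C(m, l)%:R * (rising x l * rising y (m.+1 - l)).
  rewrite -big_split; apply: eq_bigr => l _ /=.
  have lm : (l <= m)%N by rewrite -ltnS.
  rewrite subSn // !risingS -[in m%:R](subnKC lm) natrD.
  ring.
rewrite [RHS]big_ord_recl /= bin0.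
under [X in _ = _ + X]eq_bigr => l _ do rewrite /bump /= add1n binS natrD mulrDl subSS.
rewrite big_split /= addrA addrC; congr (_ + _).
rewrite big_ord_recl /= bin0; congr (_ + _).
rewrite [RHS]big_ord_recr /= bin_small // mul0r addr0.
by apply: eq_bigr => l _; rewrite /bump /= add1n subSS.
Qed.

Lemma rising_polyC (R : comNzRingType) (a : R) (m : nat) :
  rising a%:P m = (rising a m)%:P.
Proof.
rewrite /rising rmorph_prod; apply: eq_bigr => i _ /=.
by rewrite polyCD polyC_natr.
Qed.

Lemma horner_rising (R : comNzRingType) (a : R) (m : nat) :
  (rising 'X m).[a] = rising a m.
Proof.
rewrite /rising horner_prod; apply: eq_bigr => i _.
by rewrite hornerD hornerX -polyC_natr hornerC.
Qed.

Lemma comp_rising (R : comNzRingType) (q : {poly R}) (m : nat) :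
  rising 'X m \Po q = rising q m.
Proof.
rewrite /rising rmorph_prod; apply: eq_bigr => i _ /=.
by rewrite comp_polyD comp_polyX -polyC_natr comp_polyC.
Qed.

(** Induction through the recurrence S_(m+1)^(k) = S_m^(k-1) - m S_m^(k). The exponent m + k has the
    parity of m - k and avoids truncated subtraction when k > m. *)
Lemma coef_rising (R : comNzRingType) (m k : nat) :
  (rising ('X : {poly R}) m)`_k = (-1) ^+ (m + k) * (stirling1 m k)%:~R.
Proof.
elim: m k => [|m IHm] k.
  rewrite /rising /stirling1 !big_ord0 !coef1.
  by case: k => [|k] /=; rewrite ?mulr1 // mulr0.
have -> : stirling1 m.+1 k
        = (if k is k'.+1 then stirling1 m k' else 0) - stirling1 m k * m%:R.
  by rewrite /stirling1 big_ord_recr /= mulrBr coefB coefMX coefMC; case: k.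
rewrite risingS mulrDr coefD coefMX -polyC_natr coefMC.
case: k => [|k] /=; rewrite !IHm ?addSn ?addnS !exprS rmorphB rmorphM /=.
  by rewrite !rmorph_nat; ring.
by rewrite !rmorph_nat; ring.
Qed.

Lemma size_rising (R : comNzRingType) (m : nat) :
  (size (rising ('X : {poly R}) m) <= m.+1)%N.
Proof.
elim: m => [|m IHm]; first by rewrite /rising big_ord0 size_poly1.
rewrite risingS (leq_trans (size_polyMleq _ _)) //.
rewrite -polyC_natr size_XaddC addn2 /=.
by rewrite ltnS.
Qed.

(* The integral of (x + 1/2 - alpha) x^k over x in [alpha - 1, alpha], as a
   polynomial in alpha = 'X. *)
Definition binet_kernel (R : numFieldType) (k : nat) : {poly R} :=
  (k + 2)%:R^-1 *: ('X^(k + 2) - ('X - 1) ^+ (k + 2))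
  + (k + 1)%:R^-1 *: ((2%:R^-1%:P - 'X) * ('X^(k + 1) - ('X - 1) ^+ (k + 1))).

Lemma binet_kernel0 (R : numFieldType) : binet_kernel R 0 = 0.
Proof.
rewrite /binet_kernel !add0n expr1 invr1 scale1r -mul_polyC.
have h : (2%:R^-1 : R)%:P * 2%:R = 1.
  by rewrite -polyC_natr -polyCM mulVf ?pnatr_eq0.
rewrite expr1; move: h; set c := _%:P => h.
transitivity ((c * 2%:R - 1) * ('X : {poly R})); first by ring.
by rewrite h subrr mul0r.
Qed.

(** Appell property: in the form (t + 1/2)(t + alpha)^k, the integrand depends on alpha only through
    the power. *)
Lemma deriv_binet_kernel (R : numFieldType) (k : nat) :
  (binet_kernel R k)^`() = k%:R *: binet_kernel R k.-1.
Proof.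
case: k => [|k]; first by rewrite binet_kernel0 deriv0 scale0r.
have dX n : ('X^(n.+1) : {poly R})^`() = n.+1%:R *: 'X^n.
  by rewrite derivXn scaler_nat.
have dY n : (('X - 1) ^+ n.+1 : {poly R})^`() = n.+1%:R *: ('X - 1) ^+ n.
  by rewrite deriv_exp derivB derivX -[1]/1%:P derivC subr0 mul1r scaler_nat.
rewrite /binet_kernel !addn1 !addn2 derivD !derivZ derivM !derivB.
rewrite !dX !dY derivC derivX sub0r -!scalerBr -scalerAr.
rewrite [k.+1.-1]/=.
set A := 'X^(k.+2) - _; set B := 'X^(k.+1) - _; set C := _ * B.
rewrite mulN1r [_ *: (- A + _)]scalerDr [in RHS]scalerDr !scalerA.
rewrite !mulVf ?pnatr_eq0 // divff ?pnatr_eq0 // !scale1r addrA; congr (_ + _).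
(* The coefficients of [A] agree: 1 - 1/(k + 2) = (k + 1)/(k + 2). *)
rewrite scalerN -{1}[A]scale1r -scalerBl; congr (_ *: _).
have k2 : k.+2%:R != 0 :> R by rewrite pnatr_eq0.
by apply: (mulIf k2); rewrite mulrBl mulfVK // mulVf // mul1r -[k.+2]addn1 natrD addrK.
Qed.

Lemma derivn_binet_kernel (R : numFieldType) (k i : nat) :
  (binet_kernel R k)^`(i) = (k ^_ i)%:R *: binet_kernel R (k - i).
Proof.
elim: i => [|i IHi]; first by rewrite derivn0 ffactn0 scale1r subn0.
rewrite derivnS IHi derivZ deriv_binet_kernel scalerA -natrM -ffactnSr.
by rewrite subnS.
Qed.

Lemma nderivn_binet_kernel (R : numFieldType) (k i : nat) :
  (binet_kernel R k)^`N(i) = 'C(k, i)%:R *: binet_kernel R (k - i).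
Proof.
have fi0 : i`!%:R != 0 :> R by rewrite pnatr_eq0 -lt0n fact_gt0.
apply: (scalerI fi0).
rewrite scalerA -natrM mulnC bin_ffact -derivn_binet_kernel nderivn_def.
by rewrite scaler_nat.
Qed.

(** Taylor expansion at 0, with the order of summation reversed. Any bound n > k is allowed, so that
    sums over different k share one range. *)
Lemma horner_binet_kernel (R : numFieldType) (n k : nat) (a : R) :
  (k < n)%N ->
  (binet_kernel R k).[a] =
    \sum_(i < n) 'C(k, i)%:R * a ^+ (k - i) * (binet_kernel R i).[0].
Proof.
move=> kn.
set N := maxn (size (binet_kernel R k)) k.+1.
have widen (F : nat -> R) p : (k < p)%N ->
    \sum_(i < p) 'C(k, i)%:R * F i = \sum_(i < k.+1) 'C(k, i)%:R * F i.
  move=> kp; rewrite [RHS](big_ord_widen p (fun i => 'C(k, i)%:R * F i)) //.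
  rewrite [RHS]big_mkcond /=; apply: eq_bigr => i _.
  by case: ltnP => // ki; rewrite bin_small // mul0r.
rewrite -[a in LHS]add0r (@nderiv_taylor_wide _ N) ?leq_maxl //; last first.
  by rewrite /GRing.comm mul0r mulr0.
under eq_bigr => i _ do rewrite nderivn_binet_kernel hornerZ -mulrA.
rewrite (widen (fun i => (binet_kernel R (k - i)).[0] * a ^+ i)) ?leq_maxr //.
under [RHS]eq_bigr => i _ do rewrite -mulrA.
rewrite (widen (fun i => a ^+ (k - i) * (binet_kernel R i).[0])) //.
rewrite (reindex_inj rev_ord_inj).
apply: eq_bigr => i _ /=.
have ik : (i <= k)%N by rewrite -ltnS.
by rewrite subSS bin_sub // subKn // [_ * a ^+ _]mulrC.
Qed.

(* Extending [X^i |-> binet_kernel i] linearly gives an operator that commutes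
   with translations. *)
Lemma sum_coef_binet_kernel_shift (R : numFieldType) (n : nat) (p : {poly R})
    (a : R) :
  (size p <= n)%N ->
  \sum_(k < n) p`_k * (binet_kernel R k).[a] =
    \sum_(i < n) (p \Po ('X + a%:P))`_i * (binet_kernel R i).[0].
Proof.
move=> pn.
under eq_bigr => k _ do
  rewrite (horner_binet_kernel a (ltn_ord k)) mulr_sumr.
rewrite exchange_big /=; apply: eq_bigr => i _.
rewrite coef_comp_poly (big_ord_widen n (fun k => p`_k * (('X + a%:P) ^+ k)`_i)) //.
rewrite [in RHS]big_mkcond /= mulr_suml; apply: eq_bigr => k _.
case: ltnP => [_|pk]; last by rewrite nth_default // !mul0r.
rewrite -[RHS]mulrA; congr (_ * (_ * _)).
(* In the binomial expansion only the term j = i contributes to the coefficient of X^i; for i > k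
   there is none. *)
rewrite addrC exprDn coef_sum.
have [ik|ki] := leqP i k; last first.
  rewrite bin_small // mul0r big1 // => j _.
  rewrite coefMn -rmorphXn coefCM coefXn.
  by rewrite gtn_eqF ?mulr0 ?mul0rn // (leq_trans _ ki).
rewrite (bigD1 (Ordinal (ik : (i < k.+1)%N))) //= big1 ?addr0 => [|j ji].
  by rewrite coefMn -rmorphXn coefCM coefXn eqxx mulr1 mulr_natl.
rewrite coefMn -rmorphXn coefCM coefXn eq_sym -[j == i :> nat]/(j == Ordinal (ik : (i < k.+1)%N)).
by rewrite (negbTE ji) mulr0 mul0rn.
Qed.

Lemma signr_addn_subn (R : pzRingType) (m k : nat) :
  (k <= m)%N -> (-1) ^+ (m + k) = (-1) ^+ (m - k) :> R.
Proof. by move=> km; rewrite -signr_odd -[RHS]signr_odd oddD oddB. Qed.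

(** The index k = 0 may be added because its kernel is 0, and the indices k > m because r_m has
    degree m. *)
Lemma binet_polyE (R : numFieldType) (n m : nat) :
  (m < n)%N ->
  binet_poly R m =
    m%:R^-1 *: \sum_(k < n) (rising 'X m)`_k *: binet_kernel R k.
Proof.
move=> mn; rewrite /binet_poly; congr (_ *: _).
rewrite -(big_mkord xpredT (fun k => (rising 'X m)`_k *: binet_kernel R k)).
rewrite (@big_cat_nat _ _ _ m.+1 0 n) //= [X in _ = _ + X]big1_seq ?addr0; last first.
  move=> k; rewrite mem_index_iota => /andP[_ /andP[mk _]].
  by rewrite nth_default ?scale0r // (leq_trans (size_rising _ _)).
rewrite [RHS]big_ltn // binet_kernel0 scaler0 add0r.
apply: eq_big_nat => k /andP[_ km]; congr (_ *: _).
rewrite coef_rising; congr (_ * _).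
by rewrite signr_addn_subn // -opprB subzn // -exprnN invr_sign.
Qed.

Lemma poly_horner_inj (R : numFieldType) (p q : {poly R}) :
  (forall a, p.[a] = q.[a]) -> p = q.
Proof.
move=> pq; apply/eqP; rewrite -subr_eq0; apply/eqP.
(* In characteristic 0 the naturals below [size r] are distinct roots, too many for a nonzero
   [r]. *)
pose r := p - q; pose s := [seq i%:R : R | i <- iota 0 (size r)].
apply: (@roots_geq_poly_eq0 _ r s).
- by apply/allP => a _; rewrite /root hornerD hornerN pq subrr.
- rewrite map_inj_uniq ?iota_uniq // => i j /eqP.
  by rewrite eqr_nat => /eqP.
- by rewrite size_map size_iota.
Qed.

Lemma binet_poly_rising (R : numFieldType) (m : nat) : (0 < m)%N ->
  binet_poly R m =
    \sum_(l < m) ('C(m - 1, l)%:R * binet_c R (m - l)) *: rising 'X l.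
Proof.
move=> m0; apply: poly_horner_inj => a.
rewrite (@binet_polyE _ m.+1) // hornerZ !horner_sum.
under eq_bigr => k _ do rewrite hornerZ.
rewrite sum_coef_binet_kernel_shift ?size_rising // comp_rising addrC rising_add.
under eq_bigr => k _ do rewrite coef_sum mulr_suml.
(* For l = m the factor r_0 is constant, so only the zero kernel of index 0 could contribute. *)
rewrite exchange_big /= big_ord_recr /= [X in _ + X]big1 ?addr0; last first.
  move=> k _; rewrite subnn [rising _ 0]big_ord0 mulr1 rising_polyC.
  rewrite -polyC_natr -polyCM coefC.
  by case: k => [[|k] kP] /=; rewrite ?binet_kernel0 ?horner0 ?mulr0 ?mul0r.
rewrite mulr_sumr; apply: eq_bigr => l _.
rewrite hornerZ horner_rising /binet_c (@binet_polyE _ m.+1); last first.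
  by rewrite ltnS leq_subr.
rewrite hornerZ horner_sum.
have ml0 : (m - l)%:R != 0 :> R by rewrite pnatr_eq0 -lt0n subn_gt0.
have m0' : m%:R != 0 :> R by rewrite pnatr_eq0 -lt0n.
(* The factor m - l cancels the 1/(m - l) inside c_(m - l). *)
have -> : 'C(m - 1, l)%:R = m%:R^-1 * (m - l)%:R * 'C(m, l)%:R :> R.
  by rewrite -mulrA -natrM -mul_bin_down natrM mulKf // subn1.
under [in RHS]eq_bigr => k _ do rewrite hornerZ.
set T := \sum_(_ < _) _; set S := \sum_(_ < _) _.
have -> : T = 'C(m, l)%:R * rising a l * S.
  rewrite /T /S mulr_sumr; apply: eq_bigr => k _.
  rewrite rising_polyC -polyC_natr mulrA -polyCM coefCM.
  by rewrite !mulrA.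
rewrite mulrA; field.
by rewrite m0' ml0.
Qed.

Theorem mainTheorem6 (R : numFieldType) (m : nat) (hm : (1 <= m)%N) :
  binet_poly R m = \sum_(0 <= j < m) binet_coef R j m *: 'X^j
  /\ (forall j : nat, (j <= m - 1)%N ->
        binet_coef R j m =
          \sum_(j <= l < m)
            'C(m - 1, l)%:R * (stirling1 l j)%:~R * (-1) ^+ (l - j)
              * binet_c R (m - l)).
Proof.
split=> [|j jm].
  rewrite big_mkord -poly_def; apply/polyP => i; rewrite coef_poly.
  case: ltnP => // mi; rewrite nth_default // (leq_trans _ mi) //.
  rewrite binet_poly_rising //; apply: (leq_trans (size_sum _ _ _)).
  apply/bigmax_leqP => l _.
  exact: leq_trans (size_scale_leq _ _) (leq_trans (size_rising _ _) _).
rewrite /binet_coef binet_poly_rising // coef_sum.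
rewrite -(big_mkord xpredT
  (fun l => (('C(m - 1, l)%:R * binet_c R (m - l)) *: rising 'X l)`_j)).
(* The terms l < j vanish, since r_l has degree l. *)
rewrite (@big_cat_nat _ _ _ j 0 m) //=; last by rewrite (leq_trans jm) ?leq_subr.
rewrite big1_seq ?add0r => [|l]; last first.
  rewrite mem_index_iota => /andP[_ /andP[_ lj]].
  by rewrite coefZ nth_default ?mulr0 // (leq_trans (size_rising _ _)).
apply: eq_big_nat => l /andP[jl _].
rewrite coefZ coef_rising signr_addn_subn //.
by ring.
Qed.
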